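(* For every positive integer $n$ and every proper prime power $q$ (that is, $q=p^k$ with $p$ prime and $k\ge 2$), the complete bipartite graph $K_{n,n}$ is not linearly $q$-solvable.
   Context: Let $G$ be a finite simple graph with vertices $v_1,\ldots,v_N$, let $q$ be a prime power, and let the set of colors be the finite field $\mathbb{F}_q$. A coloring is any $x\in\mathbb{F}_q^N$, where $x_i$ is the color of $v_i$. A linear guessing strategy over $\mathbb{F}_q$ is a choice, for each $i$, of an affine function $f_i(x)=\sum_{j\in N_i}a_{i,j}x_j+b_i$ with $a_{i,j},b_i\in\mathbb{F}_q$, where $N_i$ is the set of indices of the neighbors of $v_i$; vertex $v_i$ guesses correctly on $x$ if $f_i(x)=x_i$. $G$ is linearly $q$-solvable if there is a linear guessing strategy over $\mathbb{F}_q$ such that for every $x\in\mathbb{F}_q^N$ at least one vertex guesses correctly. *)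

(* Defs.v *)
From HB Require Import structures.
From mathcomp Require Import all_boot all_order all_algebra all_field.

Set Implicit Arguments.
Unset Strict Implicit.
Unset Printing Implicit Defensive.

Import GRing.Theory.
Local Open Scope ring_scope.

Record sgraph := SGraph {
  vertex :> finType;
  adj : rel vertex;
  adj_sym : symmetric adj;
  adj_irrefl : irreflexive adj }.

Definition coloring (F : finFieldType) (G : sgraph) := {ffun G -> F}.

(* Only the coefficients [coef i j] with [j] a neighbor of [i] are ever used,
   see [guess]. *)
Record linear_strategy (F : finFieldType) (G : sgraph) := LinearStrategy {
  coef : G -> G -> F;
  const : G -> F }.

Definition guess (F : finFieldType) (G : sgraph) (s : linear_strategy F G)
    (i : G) (x : coloring F G) : F :=
  \sum_(j | adj i j) coef s i j * x j + const s i.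

(* "Linearly q-solvable", for F a field with q elements. *)
Definition linearly_solvable (F : finFieldType) (G : sgraph) : Prop :=
  exists s : linear_strategy F G,
    forall x : coloring F G, exists i : G, guess s i x = x i.

Definition bip_adj (m n : nat) : rel ('I_m + 'I_n)%type :=
  fun u v => match u, v with
             | inl _, inr _ | inr _, inl _ => true
             | _, _ => false
             end.

Lemma bip_adj_sym m n : symmetric (@bip_adj m n).
Proof. by case=> i [] j. Qed.

Lemma bip_adj_irrefl m n : irreflexive (@bip_adj m n).
Proof. by case. Qed.

Definition complete_bipartite (m n : nat) : sgraph :=
  SGraph (@bip_adj_sym m n) (@bip_adj_irrefl m n).

(* Main.v *)
Require Import Defs.
From HB Require Import structures.
From mathcomp Require Import all_boot all_order all_algebra all_field.
From mathcomp Require Import zify.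

(** Write the left colours as [x] and the right colours as [y], and let [u] be
    the errors of the left guesses and [v] those of the right guesses.  Since
    the left guesses depend on [y] only, [(u, y)] and [(x, y)] determine each
    other affinely; since the right guesses depend on [x] only, so do [(x, y)]
    and [(x, v)].  Hence [(u, y)] and [(x, v)] are two affine coordinate
    systems [z] and [w] on the space of colourings, and it is enough to find a
    point where no coordinate of either system vanishes: there all the entries
    of [u] and of [v] are nonzero, so every vertex guesses wrong.

    That such a point exists over a field of proper prime power order is an
    affine form of a theorem of Alon and Tarsi ([common_nonvanishing_point]).
    With [q] the order of the field and [p] its characteristic, the sum over
    all points of [\prod_i z_i ^ (q - p) * \prod_i w_i ^ (p - 1)] is nonzero,
    and both exponents are positive because [q > p].  To see this, regard
    [f |-> \sum_z (\prod_i z_i ^ (q - p)) * f z] as a linear functional.  On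
    the [z]-monomials of degree at most [m (p - 1)], [m] being the number of
    coordinates, it vanishes except at [\prod_i z_i ^ (p - 1)], by the usual
    evaluation of power sums over a finite field.  By the Frobenius identity it
    also vanishes on every multiple, within this degree, of the [p]-th power of
    an affine form, in particular on the [w]-monomials with an exponent at least
    [p]; those with all exponents below [p] have degree less than [m (p - 1)],
    hence are killed, except for [\prod_i w_i ^ (p - 1)].  If this last one were
    killed too, so would be every polynomial of degree at most [m (p - 1)] in
    [w]; as each [z_i] is affine in [w], this includes [\prod_i z_i ^ (p - 1)],
    where the value of the functional is [1] or [-1]. *)

Set Implicit Arguments.
Unset Strict Implicit.
Unset Printing Implicit Defensive.

Import GRing.Theory.
Local Open Scope ring_scope.

(** * Affine combinations of functions *)

Section Affine.
Variables (F : fieldType) (X : Type) (I : finType).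
Implicit Types (w : I -> X -> F) (L : X -> F).

Definition affine_in w L :=
  exists a : I -> F, exists b : F, forall x, L x = \sum_i a i * w i x + b.

Lemma affine_coord w i : affine_in w (w i).
Proof.
exists (fun j => (j == i)%:R), 0 => x.
rewrite addr0 (bigD1 i) //= eqxx mul1r big1 ?addr0 // => j /negPf ->.
by rewrite mul0r.
Qed.

Lemma affine_cst w c : affine_in w (fun=> c).
Proof.
by exists (fun=> 0), c => x; rewrite big1 ?add0r // => i _; rewrite mul0r.
Qed.

Lemma affine_add w L1 L2 :
  affine_in w L1 -> affine_in w L2 -> affine_in w (fun x => L1 x + L2 x).
Proof.
move=> [a1 [b1 E1]] [a2 [b2 E2]]; exists (fun i => a1 i + a2 i), (b1 + b2) => x.
rewrite E1 E2 addrACA -big_split /=; congr (_ + _).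
by apply: eq_bigr => i _; rewrite mulrDl.
Qed.

Lemma affine_scale w c L : affine_in w L -> affine_in w (fun x => c * L x).
Proof.
move=> [a [b E]]; exists (fun i => c * a i), (c * b) => x.
rewrite E mulrDr mulr_sumr; congr (_ + _).
by apply: eq_bigr => i _; rewrite mulrA.
Qed.

Lemma affine_ext w L1 L2 : L1 =1 L2 -> affine_in w L1 -> affine_in w L2.
Proof. by move=> E [a [b Eab]]; exists a, b => x; rewrite -E. Qed.

Lemma affine_sum w (J : finType) (P : pred J) (L : J -> X -> F) :
  (forall j, P j -> affine_in w (L j)) ->
  affine_in w (fun x => \sum_(j | P j) L j x).
Proof.
move=> affL; elim: (index_enum J) => [|j r IHr].
  by apply: affine_ext (affine_cst w 0) => x; rewrite big_nil.
apply: (@affine_ext _ (fun x => (if P j then L j x else 0)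
                                + \sum_(i <- r | P i) L i x)) => [x|].
  by rewrite big_cons; case: ifP => // _; rewrite add0r.
apply: affine_add IHr; case: (boolP (P j)) => [/affL //|_]; exact: affine_cst.
Qed.

End Affine.

(** * Functionals vanishing on monomials of bounded degree *)

Definition monomial (F : fieldType) (X : Type) (I : finType)
    (w : I -> X -> F) (al : I -> nat) (x : X) : F :=
  \prod_i w i x ^+ al i.

Lemma monomial_shift (F : fieldType) (X : Type) (I : finType)
    (w : I -> X -> F) (al be : I -> nat) (j : I) (c : nat) (x : X) :
  (forall i, be i = al i + c * (i == j))%N ->
  monomial w be x = w j x ^+ c * monomial w al x.
Proof.
move=> E; rewrite /monomial.
under eq_bigr => i _ do rewrite E exprD.
rewrite big_split /= mulrC; congr (_ * _).
rewrite (bigD1 j) //= eqxx muln1 big1 ?mulr1 // => i /negPf ->.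
by rewrite muln0 expr0.
Qed.

Lemma sum_shift (I : finType) (al be : I -> nat) (j : I) (c : nat) :
  (forall i, be i = al i + c * (i == j))%N ->
  (\sum_i be i = \sum_i al i + c)%N.
Proof.
move=> E; under eq_bigr => i _ do rewrite E.
rewrite big_split /=; congr addn.
rewrite (bigD1 j) //= eqxx muln1 big1 ?addn0 // => i /negPf ->.
by rewrite muln0.
Qed.

Section Kills.
Variables (F : fieldType) (X : finType).

(** The weight [h] stands for the functional [f |-> \sum_x h x * f x]. *)
Definition kills (I : finType) (h : X -> F) (w : I -> X -> F) (d : nat) :=
  forall al : I -> nat, (\sum_i al i <= d)%N ->
    \sum_x h x * monomial w al x = 0.

Lemma kills_mul (I : finType) (h L : X -> F) (w : I -> X -> F) d :
  affine_in w L -> kills h w d.+1 -> kills (fun x => h x * L x) w d.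
Proof.
move=> [a [b E]] hk al le_d.
transitivity (\sum_i a i * (\sum_x h x *
                monomial w (fun k => al k + 1 * (k == i))%N x)
              + b * \sum_x h x * monomial w al x).
  under [in RHS]eq_bigr => i _ do rewrite mulr_sumr.
  rewrite exchange_big /= mulr_sumr -big_split /=.
  apply: eq_bigr => x _; rewrite E mulrDr mulrDl; congr (_ + _).
    rewrite mulr_sumr mulr_suml; apply: eq_bigr => i _.
    rewrite [in RHS](@monomial_shift _ _ _ _ al _ i 1) // expr1.
    by rewrite !mulrA [a i * h x]mulrC.
  by rewrite [h x * b]mulrC mulrA.
rewrite hk ?mulr0 ?addr0; last exact: leqW.
rewrite big1 // => i _; rewrite hk ?mulr0 //.
by rewrite (@sum_shift _ al _ i 1) // addn1.
Qed.

(** A [v]-monomial of degree at most [d] is a polynomial of degree at most [d]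
    in [w].  Rather than expanding it, the proof absorbs its factors into the
    weight one at a time, which is why the weight is generalised in the
    induction. *)
Lemma kills_affine (I J : finType) (h : X -> F) (w : I -> X -> F)
    (v : J -> X -> F) d :
  (forall j, affine_in w (v j)) -> kills h w d -> kills h v d.
Proof.
move=> affv; elim: d h => [|d IHd] h hk be le_d;
  have [/forallP be0|] := boolP [forall j, be j == 0%N].
1,3: have le0 D : (\sum_(i : I) 0 <= D)%N by rewrite big1.
1,2: rewrite -[RHS](hk (fun=> 0%N) (le0 _)); apply: eq_bigr => x _.
1,2: congr (_ * _); rewrite /monomial [RHS]big1 // big1 // => j _.
1,2: by rewrite (eqP (be0 j)).
all: rewrite negb_forall => /existsP[j]; rewrite -lt0n => bej.
  by move: le_d; rewrite (bigD1 j) //=; lia.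
pose al i := (be i - 1 * (i == j))%N.
have E i : (be i = al i + 1 * (i == j))%N.
  by rewrite /al; case: eqP => [->|_] /=; lia.
have /(IHd _) hvk := kills_mul (affv j) hk.
rewrite -[RHS](hvk al); last by move: le_d; rewrite (sum_shift E) addn1.
by apply: eq_bigr => x _; rewrite (monomial_shift _ _ E) expr1 mulrA.
Qed.

End Kills.

(** * Power sums over a finite field *)

Section PowerSums.
Variable F : finFieldType.

Lemma card_finField_eq0 : #|F|%:R = 0 :> F.
Proof.
(* Translating the sum of all the elements by 1 adds [#|F|] to it. *)
apply: (@addrI _ (\sum_(c : F) c)); rewrite addr0.
rewrite [RHS](reindex_inj (addIr (1 : F))) /= big_split /=; congr (_ + _).
by rewrite sumr_const.
Qed.

Lemma power_sum_eq0 a : (a < #|F|.-1)%N -> \sum_(c : F) c ^+ a = 0.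
Proof.
case: a => [|a] lt_a.
  under eq_bigr => c _ do rewrite expr0.
  by rewrite sumr_const; exact: card_finField_eq0.
(* There are too few roots of unity to exhaust the nonzero elements. *)
have [g g0 ga] : exists2 g : F, g != 0 & g ^+ a.+1 != 1.
  have [/forallP all1|] := boolP [forall g : F, (g != 0) ==> (g ^+ a.+1 == 1)].
    have := @max_unity_roots _ a.+1 (enum (predC1 (0 : F))) isT.
    rewrite -cardE cardC1 enum_uniq => le_a; move: lt_a; rewrite ltnNge le_a //.
    apply/allP => g; rewrite mem_enum inE => g0.
    by rewrite unity_rootE (implyP (all1 g)).
  by rewrite negb_forall => /existsP[g]; rewrite negb_imply => /andP[]; exists g.
set S := \sum_c _; have gS : g ^+ a.+1 * S = S.
  rewrite [RHS](reindex_inj (mulfI g0)) mulr_sumr.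
  by apply: eq_bigr => c _; rewrite exprMn.
apply: contraNeq ga => S0.
by rewrite -(inj_eq (mulIf S0)) gS mul1r.
Qed.

Lemma power_sum_card_pred : \sum_(c : F) c ^+ #|F|.-1 = -1.
Proof.
have F1 : (1 < #|F|)%N := finRing_gt1 F.
rewrite (bigD1 0) //= expr0n -subn1 subn_eq0 leqNgt F1 add0r.
have E (c : F) : c != 0 -> c ^+ (#|F| - 1) = 1.
  move=> c0; apply: (mulfI c0); rewrite -exprS subn1 prednK ?(ltnW F1) //.
  by rewrite expf_card mulr1.
rewrite (eq_bigr (fun=> 1)) // sumr_const cardC1.
by rewrite -[in RHS](add0r (-1)) -card_finField_eq0 -subn1 natrB // ltnW.
Qed.

Lemma sum_monomial (I : finType) (al : I -> nat) :
  \sum_(z : {ffun I -> F}) \prod_i z i ^+ al i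
    = \prod_i \sum_(c : F) c ^+ al i.
Proof. by rewrite bigA_distr_bigA. Qed.

End PowerSums.

(** * Common nonvanishing points of two affine coordinate systems *)

Section Nonvanishing.
Variables (F : finFieldType) (I : finType) (p k : nat).
Hypotheses (pr_p : prime p) (k2 : (2 <= k)%N) (cardF : #|F| = (p ^ k)%N).

Let z (i : I) (x : {ffun I -> F}) : F := x i.
Let h (x : {ffun I -> F}) : F := \prod_i x i ^+ (#|F| - p).

Lemma card_gt_char : (p < #|F|)%N.
Proof.
by rewrite cardF -[X in (X < _)%N]expn1 ltn_exp2l // prime_gt1.
Qed.

Lemma sum_weight_monomial (al : I -> nat) :
  \sum_x h x * monomial z al x
    = \prod_i \sum_(c : F) c ^+ (#|F| - p + al i).
Proof.
rewrite -sum_monomial; apply: eq_bigr => x _; rewrite -big_split /=.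
by apply: eq_bigr => i _; rewrite exprD.
Qed.

Lemma sum_weight_monomial_top : \sum_x h x * monomial z (fun=> p.-1) x != 0.
Proof.
rewrite sum_weight_monomial prodf_seq_neq0; apply/allP => i _ /=.
have -> : (#|F| - p + p.-1 = #|F|.-1)%N.
  by have := card_gt_char; have := prime_gt0 pr_p; rewrite !cardF; lia.
by rewrite power_sum_card_pred oppr_eq0 oner_eq0.
Qed.

Lemma sum_cst (c : nat) : (\sum_(i : I) c = #|I| * c)%N.
Proof. by rewrite big_const iter_addn_0 mulnC. Qed.

Lemma exponent_lt (al : I -> nat) (i : I) :
  (\sum_i al i <= #|I| * p.-1)%N -> al i != p.-1 -> exists j, (al j < p.-1)%N.
Proof.
move=> le_al ne_i.
have [/existsP[j lt_j]|] := boolP [exists j, (al j < p.-1)%N]; first by exists j.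
rewrite negb_exists => /forallP ge_al; exfalso.
move: le_al; rewrite -sum_cst (bigD1 i) //= [X in (_ <= X)%N](bigD1 i) //=.
have : (\sum_(j | j != i) p.-1 <= \sum_(j | j != i) al j)%N.
  by apply: leq_sum => j _; rewrite leqNgt.
by have := ge_al i; lia.
Qed.

(** Within this degree, an exponent other than [p - 1] forces one below [p - 1];
    adding the [#|F| - p] of the weight leaves it below [#|F| - 1], and the
    corresponding power sum is zero. *)
Lemma sum_weight_monomial_eq0 (al : I -> nat) (i : I) :
  (\sum_i al i <= #|I| * p.-1)%N -> al i != p.-1 ->
  \sum_x h x * monomial z al x = 0.
Proof.
move=> le_al /(exponent_lt le_al)[j lt_j].
rewrite sum_weight_monomial (bigD1 j) //= power_sum_eq0 ?mul0r //.
by have := card_gt_char; rewrite !cardF; lia.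
Qed.

Lemma kills_weight d : (d < #|I| * p.-1)%N -> kills h z d.
Proof.
move=> lt_d al le_al.
have [i ne_i] : exists i, al i != p.-1.
  apply/existsP; apply: contraTT le_al; rewrite negb_exists -ltnNge.
  move=> /forallP al1; apply: leq_trans lt_d _.
  by rewrite -sum_cst leq_sum // => i _; move/negPn: (al1 i) => /eqP ->.
apply: sum_weight_monomial_eq0 ne_i.
exact: leq_trans le_al (ltnW lt_d).
Qed.

(** By the Frobenius identity [L ^ p] is a combination of the [z_l ^ p] and 1.
    After multiplication by a [z]-monomial of degree at most [d], the former
    have an exponent at least [p] and the latter has degree less than
    [#|I| * (p - 1)], so [\prod_i z_i ^ (p - 1)] does not arise. *)
Lemma kills_weight_Frobenius (L : {ffun I -> F} -> F) d :
  affine_in z L -> (d + p <= #|I| * p.-1)%N ->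
  kills (fun x => h x * L x ^+ p) z d.
Proof.
move=> [a [b E]] le_d al le_al.
have p_gt0 := prime_gt0 pr_p.
have pchF : p \in [pchar F] := card_finPcharP cardF pr_p.
have Lp x : L x ^+ p = \sum_i a i ^+ p * z i x ^+ p + b ^+ p.
  rewrite E -!(pFrobenius_autE pchF) rmorphD rmorph_sum; congr (_ + _).
  by apply: eq_bigr => i _; rewrite /= !pFrobenius_autE exprMn.
transitivity (\sum_i a i ^+ p * (\sum_x h x *
                monomial z (fun l => al l + p * (l == i))%N x)
              + b ^+ p * \sum_x h x * monomial z al x).
  under [in RHS]eq_bigr => i _ do rewrite mulr_sumr.
  rewrite exchange_big /= mulr_sumr -big_split /=.
  apply: eq_bigr => x _; rewrite Lp mulrDr mulrDl; congr (_ + _).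
    rewrite mulr_sumr mulr_suml; apply: eq_bigr => i _.
    rewrite [in RHS](@monomial_shift _ _ _ _ al _ i p) //.
    by rewrite !mulrA [_ * h x]mulrC.
  by rewrite [h x * _]mulrC mulrA.
rewrite (@kills_weight d) ?mulr0 ?addr0 //; last by lia.
rewrite big1 // => i _; rewrite (@sum_weight_monomial_eq0 _ i) ?mulr0 //.
  by rewrite (@sum_shift _ al _ i p) //; lia.
by rewrite eqxx; lia.
Qed.

(** The sum of [h x * monomial w (fun=> p.-1) x] is nonzero, and a point where
    its term is nonzero is as required, because [#|F| - p] and [p - 1] are both
    positive. *)
Theorem common_nonvanishing_point (w : I -> {ffun I -> F} -> F) :
  (forall i, affine_in z (w i)) -> (forall i, affine_in w (z i)) ->
  exists x : {ffun I -> F}, forall i, x i != 0 /\ w i x != 0.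
Proof.
move=> affw affz.
have p_gt1 := prime_gt1 pr_p.
suff : \sum_x h x * monomial w (fun=> p.-1) x != 0.
  have [/existsP[x nz_x] _|] :=
    boolP [exists x, h x * monomial w (fun=> p.-1) x != 0].
    exists x => i; move: nz_x; rewrite mulf_eq0 negb_or.
    rewrite !prodf_seq_neq0 => /andP[/allP/(_ i) + /allP/(_ i)].
    rewrite !mem_index_enum !expf_eq0 => /(_ isT) + /(_ isT).
    rewrite subn_gt0 card_gt_char /=.
    by have -> : (0 < p.-1)%N by lia.
  rewrite negb_exists => /forallP h0; rewrite big1 ?eqxx // => x _.
  by apply/eqP/negPn.
apply: contra_neq sum_weight_monomial_top => top0.
suff hw : kills h w (#|I| * p.-1).
  by apply: (kills_affine affz hw); rewrite sum_cst.
move=> be le_be.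
have [/forallP be1|] := boolP [forall i, be i == p.-1].
  rewrite -[RHS]top0; apply: eq_bigr => x _; rewrite /monomial.
  by under eq_bigr => i _ do rewrite (eqP (be1 i)).
rewrite negb_forall => /existsP[i ne_i].
have [/existsP[j ge_j]|] := boolP [exists j, (p <= be j)%N].
  pose al l := (be l - p * (l == j))%N.
  have E l : (be l = al l + p * (l == j))%N.
    by rewrite /al; case: eqP => [->|_] /=; lia.
  have := @kills_weight_Frobenius _ (\sum_i al i)%N (affw j).
  rewrite -(sum_shift E) => /(_ le_be)/(kills_affine affw)/(_ al (leqnn _)).
  move=> al0; rewrite -[RHS]al0.
  by apply: eq_bigr => x _; rewrite (monomial_shift _ _ E) mulrA.
rewrite negb_exists => /forallP le_p.
have lt_be : (\sum_i be i < #|I| * p.-1)%N.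
  rewrite -sum_cst (bigD1 i) //= [X in (_ < X)%N](bigD1 i) //=.
  have : (\sum_(j | j != i) be j <= \sum_(j | j != i) p.-1)%N.
    by apply: leq_sum => j _; have := le_p j; lia.
  by have := le_p i; lia.
exact: (kills_affine affw (kills_weight lt_be)).
Qed.

End Nonvanishing.

(** * Guessing strategies on complete bipartite graphs *)

Theorem theorem1p11 (n p k : nat) (F : finFieldType) :
  (0 < n)%N -> prime p -> (2 <= k)%N -> #|F| = (p ^ k)%N ->
  ~ linearly_solvable F (complete_bipartite n n).
Proof.
move=> _ pr_p k2 cardF [s solv].
pose G := complete_bipartite n n.
pose z (i : G) (x : {ffun G -> F}) := x i.
(* Taking the colours as a plain function lets [gs] be applied to the colours
   [col] before they are packed into a colouring. *)
pose gs (i : G) (c : G -> F) :=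
  \sum_(j | @adj G i j) coef s i j * c j + const s i.
(* A point of [{ffun G -> F}] lists the left errors and the right colours;
   [col] recovers the colours, and [w] lists the left colours and the right
   errors. *)
pose col (i : G) (x : {ffun G -> F}) : F :=
  match i with inl _ => x i + gs i (fun j => x j) | inr _ => x i end.
pose w (i : G) (x : {ffun G -> F}) : F :=
  match i with
  | inl _ => col i x
  | inr _ => col i x - gs i (fun j => col j x)
  end.
have aff_gs v i (c : G -> {ffun G -> F} -> F) :
    (forall j, @adj G i j -> affine_in v (c j)) ->
    affine_in v (fun x => gs i (fun j => c j x)).
  move=> affc; apply: affine_add (affine_cst _ _).
  by apply: affine_sum => j /affc; apply: affine_scale.
have affN v L : affine_in v L -> affine_in v (fun x : {ffun G -> F} => - L x).
  move=> /(affine_scale (-1)); apply: affine_ext => x; exact: mulN1r.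
have aff_col i : affine_in z (col i).
  case: i => i; last exact: (affine_coord z (inr i)).
  apply: affine_add; first exact: (affine_coord z (inl i)).
  by apply: aff_gs => j _; exact: affine_coord.
have aff_w i : affine_in z (w i).
  case: i => i; first exact: aff_col.
  apply: affine_add; first exact: aff_col.
  by apply/affN/aff_gs => j _; exact: aff_col.
have aff_z_inr i : affine_in w (z (inr i)).
  apply: (@affine_ext _ _ _ _ (fun x => w (inr i) x + gs (inr i) (col^~ x))).
    by move=> x; rewrite /w subrK.
  apply: affine_add; first exact: affine_coord.
  by apply: aff_gs => -[j|j] // _; exact: (affine_coord w (inl j)).
have aff_z i : affine_in w (z i).
  case: i => i; last exact: aff_z_inr.
  apply: (@affine_ext _ _ _ _ (fun x => w (inl i) x - gs (inl i) (z^~ x))).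
    by move=> x; rewrite /w /col addrK.
  apply: affine_add; first exact: affine_coord.
  by apply/affN/aff_gs => -[j|j] // _; exact: aff_z_inr.
have [x nz_x] := common_nonvanishing_point pr_p k2 cardF aff_w aff_z.
have [i] := solv [ffun i => col i x].
have -> : guess s i [ffun i => col i x] = gs i (fun j => col j x).
  by rewrite /guess /gs; congr (_ + _); apply: eq_bigr => j _; rewrite ffunE.
rewrite ffunE; case: i => i E.
- have [/eqP xi0 _] := nz_x (inl i); apply: xi0.
  apply: (@addIr _ (gs (inl i) (fun j => x j))); rewrite add0r.
  rewrite -[LHS]/(col (inl i) x) -E /gs; congr (_ + _).
  by apply: eq_bigr => -[].
- have [_ /eqP wi0] := nz_x (inr i); apply: wi0.
  by rewrite /w -E subrr.
Qed.
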